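(* Let $K \subset \mathbb{R}^n$ be a convex body. Then $$d_{BM}(K,\mathbb{B}_2^n) \leq \sqrt{n\, s(K)}.$$ The inequality is best possible when $s(K)$ is an integer that divides $n$; that is, for every positive integer $s$ dividing $n$ there exists a convex body $K \subset \mathbb{R}^n$ with $s(K) = s$ and $d_{BM}(K,\mathbb{B}_2^n) = \sqrt{n s}$.
   Context: A convex body in $\mathbb{R}^n$ is a compact convex set with non-empty interior. The Minkowski asymmetry of a convex body $K$ is $s(K) = \inf\{\rho \geq 0 : K - c \subset \rho(c-K) \text{ for some } c \in \mathbb{R}^n\}$. $\mathbb{B}_2^n$ is the Euclidean unit ball in $\mathbb{R}^n$. The Banach--Mazur distance between convex bodies $K, L \subset \mathbb{R}^n$ is $d_{BM}(K,L) = \inf\{\rho \geq 0 : u + K \subset AL \subset v + \rho K \text{ for some invertible } A \in \mathbb{R}^{n\times n} \text{ and } u,v \in \mathbb{R}^n\}$. *)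

(* Defs.v *)
From mathcomp Require Import all_boot all_order all_algebra.
From mathcomp Require Import all_classical all_reals.
From mathcomp Require Import topology normedtype convex.

Set Implicit Arguments.
Unset Strict Implicit.
Unset Printing Implicit Defensive.

Import Order.TTheory GRing.Theory Num.Theory.
Import numFieldNormedType.Exports.

Local Open Scope classical_set_scope.
Local Open Scope ring_scope.

(* Points of R^n are column vectors.  The library's topology on 'cV[R]_n is
   the one of the sup norm, i.e., the usual topology of R^n; the library norm
   `|x| is the sup norm, so the Euclidean ball is defined by coordinates. *)

Definition convex_body (R : realType) (n : nat) (K : set 'cV[R]_n) : Prop :=
  [/\ compact K, convex_set K & interior K !=set0].

Definition euclidean_norm (R : realType) (n : nat) (x : 'cV[R]_n) : R :=
  Num.sqrt (\sum_(i < n) x i 0 ^+ 2).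

Definition euclidean_ball (R : realType) (n : nat) : set 'cV[R]_n :=
  [set x | euclidean_norm x <= 1].

(* The library's real infimum has the convention inf set0 = 0.  For convex
   bodies, the two sets of reals below are nonempty and bounded below by 0, so
   inf is the genuine infimum. *)

Definition minkowski_asymmetry (R : realType) (n : nat) (K : set 'cV[R]_n) : R :=
  inf [set rho | 0 <= rho /\
    exists c : 'cV[R]_n,
      [set x - c | x in K] `<=` [set rho *: (c - x) | x in K]].

Definition banach_mazur_distance (R : realType) (n : nat)
    (K L : set 'cV[R]_n) : R :=
  inf [set rho | 0 <= rho /\
    exists (A : 'M[R]_n) (u v : 'cV[R]_n),
      [/\ A \in unitmx,
          [set u + x | x in K] `<=` [set A *m y | y in L] &
          [set A *m y | y in L] `<=` [set v + rho *: x | x in K]]].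

(* Main.v *)
Require Import Defs.
From mathcomp Require Import all_boot all_order all_algebra.
From mathcomp Require Import all_classical all_reals.
From mathcomp Require Import topology normedtype convex.
From mathcomp Require Import interval_inference derive ring lra.

(** Upper bound.  Translate K so that [- x / s] lies in K for every [x] in K.
    A point [y] of the polar of K then satisfies [- s <= <y,x> <= 1] for [x] in
    K, so that [(1 - <y,x>) (s + <y,x>) >= 0], i.e.,
    [<y,x>^2 + (s - 1) <y,x> <= s].  Averaging over a probability measure on the
    polar, with second moment matrix [C^T C] and mean [C^T z], gives
    [|C x|^2 + (s - 1) <z, C x> <= s] for [x] in K: K lies in an ellipsoid of
    shape C.  The pairs [(C, z)] with this property and [|z| <= 1] (the second
    moment dominates the square of the mean) form a compact set, [feasible].

    On this set one maximizes [det(C)^2 / (1 + beta |z|^2)^n].  Moving a small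
    mass to a polar point, written [C^T u], is a rank-one update of the pair
    that stays feasible ([rank1_feasible]), so the first-order condition at a
    maximum reads ([maximal_pair_polar])
      [|u|^2 (1 + beta |z|^2) <= n (1 + 2 beta <u,z> - beta <u,z>^2)],
    and the right-hand side is at most [n (1 + beta <u,z>)^2].  By
    duality ([polar_separation]) this says that K contains an ellipsoid of the
    same shape C, in general with another center.  The squared ratio of the two
    ellipsoids is [n (s + (s - 1)^2 |z|^2 / 4) / (1 + beta |z|^2)], which is
    [n s] for [beta = (s - 1)^2 / (4 s)] ([ellipsoid_position]).  The inclusions
    that define the distance allow different translations on both sides, so the
    two centers need not agree.

    Sharpness.  For [n = k s] the extremal body is the product of k simplices
    of dimension s.  If an ellipsoid [A B] contains [u + K] and
    lies in [v + rho K], then the vertices of K lie in [A B - u], which bounds the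
    average of [|A^-1 x|^2] over the vertices [x] of the factors
    ([exists_far_vertex]); on the other hand the support
    value of the ellipsoid [A B] at the normal of the facet opposite to [x] is at
    least [s / |A^-1 x|], while the facet normals of each factor sum to zero, so
    these support values average to at most [rho].  The two estimates
    combine, by convexity of [1 / g] as a function of [g^2], to [rho >= sqrt (n s)]. *)

Import Order.TTheory GRing.Theory Num.Theory.
Import numFieldNormedType.Exports.
Local Open Scope classical_set_scope.
Local Open Scope ring_scope.
Set Implicit Arguments.
Unset Strict Implicit.

(** * The Euclidean inner product *)

Section Dot.
Context {R : realType}.

Definition dot {n} (u v : 'cV[R]_n) : R := \sum_i u i 0 * v i 0.

Lemma dotC n (u v : 'cV[R]_n) : dot u v = dot v u.
Proof. by apply: eq_bigr => i _; rewrite mulrC. Qed.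

Lemma dotDl n (u v w : 'cV[R]_n) : dot (u + v) w = dot u w + dot v w.
Proof. by rewrite -big_split; apply: eq_bigr => i _; rewrite mxE mulrDl. Qed.

Lemma dotDr n (u v w : 'cV[R]_n) : dot u (v + w) = dot u v + dot u w.
Proof. by rewrite dotC dotDl !(dotC u). Qed.

Lemma dotZl n k (u v : 'cV[R]_n) : dot (k *: u) v = k * dot u v.
Proof. by rewrite mulr_sumr; apply: eq_bigr => i _; rewrite mxE mulrA. Qed.

Lemma dotZr n k (u v : 'cV[R]_n) : dot u (k *: v) = k * dot u v.
Proof. by rewrite dotC dotZl dotC. Qed.

Lemma dotNl n (u v : 'cV[R]_n) : dot (- u) v = - dot u v.
Proof. by rewrite -scaleN1r dotZl mulN1r. Qed.

Lemma dotNr n (u v : 'cV[R]_n) : dot u (- v) = - dot u v.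
Proof. by rewrite dotC dotNl dotC. Qed.

Lemma dot0r n (u : 'cV[R]_n) : dot u 0 = 0.
Proof. by rewrite -(scale0r 0) dotZr mul0r. Qed.

Lemma dot_sumr n (I : finType) (u : 'cV[R]_n) (F : I -> 'cV[R]_n) :
  dot u (\sum_i F i) = \sum_i dot u (F i).
Proof. exact: (big_morph (dot u) (dotDr u) (dot0r u)). Qed.

Lemma dot_sqr n (u : 'cV[R]_n) : dot u u = \sum_i u i 0 ^+ 2.
Proof. by apply: eq_bigr => i _; rewrite expr2. Qed.

Lemma dot_ge0 n (u : 'cV[R]_n) : 0 <= dot u u.
Proof. by rewrite dot_sqr; apply: sumr_ge0 => i _; exact: sqr_ge0. Qed.

Lemma dot_eq0 n (u : 'cV[R]_n) : (dot u u == 0) = (u == 0).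
Proof.
apply/eqP/eqP => [|->]; last exact: dot0r.
rewrite dot_sqr => /eqP; rewrite psumr_eq0; last by move=> i _; exact: sqr_ge0.
move/allP => u0; apply/matrixP => i j; rewrite ord1 mxE.
by have := u0 i (mem_index_enum _); rewrite sqrf_eq0 => /eqP.
Qed.

Lemma dot_gt0 n (u : 'cV[R]_n) : (0 < dot u u) = (u != 0).
Proof. by rewrite lt_def dot_ge0 andbT dot_eq0. Qed.

Lemma dot_coord_le n (v : 'cV[R]_n) i : v i 0 ^+ 2 <= dot v v.
Proof.
rewrite dot_sqr (bigD1 i)//= lerDl; apply: sumr_ge0 => j _; exact: sqr_ge0.
Qed.
Lemma dot_mulmxl m n (A : 'M[R]_(m, n)) u v : dot (A *m u) v = dot u (A^T *m v).
Proof.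
transitivity (((A *m u)^T *m v) 0 0).
  by rewrite mxE; apply: eq_bigr => i _; rewrite [in RHS]mxE.
rewrite trmx_mul -mulmxA mxE; apply: eq_bigr => i _.
by rewrite [in LHS]mxE.
Qed.

Lemma dot_CauchySchwarz n (u v : 'cV[R]_n) :
  dot u v ^+ 2 <= dot u u * dot v v.
Proof.
have [->|v0] := eqVneq v 0; first by rewrite !dot0r expr0n mulr0.
have v_gt0 : 0 < dot v v by rewrite dot_gt0.
have := dot_ge0 (dot v v *: u - dot u v *: v).
rewrite !(dotDl, dotDr, dotNl, dotNr, dotZl, dotZr) (dotC v u).
set a := dot v v; set b := dot u v; set c := dot u u => h.
have : 0 <= a * (c * a - b ^+ 2) by move: h; congr (0 <= _); ring.
by rewrite pmulr_rge0 // subr_ge0.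
Qed.

Lemma in_euclidean_ball n (x : 'cV[R]_n) :
  @euclidean_ball R n x <-> dot x x <= 1.
Proof.
rewrite /euclidean_ball /= /euclidean_norm -dot_sqr.
by rewrite -[X in _ <= X]sqrtr1 ler_sqrt.
Qed.

End Dot.

(** * Continuity and compactness for matrices *)

(* The domains are arbitrary topological spaces, so that the neighborhood filter
   stays folded during unification; on matrices it would be unfolded. *)

Section Topology.
Context {R : realType}.

Lemma continuous_addf (T : topologicalType) (f g : T -> R) :
  continuous f -> continuous g -> continuous (fun t => f t + g t).
Proof. by move=> cf cg t; apply: cvgD; [exact: cf | exact: cg]. Qed.

Lemma continuous_mulf (T : topologicalType) (f g : T -> R) :
  continuous f -> continuous g -> continuous (fun t => f t * g t).
Proof. by move=> cf cg t; apply: cvgM; [exact: cf | exact: cg]. Qed.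

Lemma continuous_normf (T : topologicalType) (f : T -> R) :
  continuous f -> continuous (fun t => `|f t|).
Proof. by move=> cf t; apply: cvg_norm; exact: cf. Qed.

Lemma continuous_expf (T : topologicalType) (f : T -> R) k :
  continuous f -> continuous (fun t => f t ^+ k).
Proof.
move=> cf; elim: k => [|k IHk].
  by under eq_fun do rewrite expr0; exact: cst_continuous.
by under eq_fun do rewrite exprS; exact: continuous_mulf.
Qed.

Lemma continuous_sum (T : topologicalType) (I : finType) (P : pred I)
    (f : I -> T -> R) :
  (forall i, continuous (f i)) -> continuous (fun t => \sum_(i | P i) f i t).
Proof.
move=> cf t; apply: (@cvg_big R I +%R 0 P) => [|i _]; last exact: cf.
by move=> p; apply: cvgD; [exact: cvg_fst | exact: cvg_snd].
Qed.

Lemma continuous_prod (T : topologicalType) (I : finType) (f : I -> T -> R) :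
  (forall i, continuous (f i)) -> continuous (fun t => \prod_i f i t).
Proof.
move=> cf t; apply: (@cvg_big R I *%R 1 xpredT) => [|i _]; last exact: cf.
by move=> p; apply: cvgM; [exact: cvg_fst | exact: cvg_snd].
Qed.

Lemma near_forall_lt (T : topologicalType) (I : finType) (f : I -> T -> R) b t :
  (forall i, continuous (f i)) -> (forall i, f i t < b) ->
  \forall t' \near t, forall i, f i t' < b.
Proof.
move=> cf ftb; apply: filter_forall => i.
by apply: (@cvgr_lt _ _ _ _ _ (f i t)); [exact: cf | exact: ftb].
Qed.

Lemma continuous_coord (T : topologicalType) m n (f : T -> 'M[R]_(m, n)) i j :
  continuous f -> continuous (fun t => f t i j).
Proof.
move=> cf t; apply: (@continuous_comp _ _ _ f (fun M : 'M[R]_(m, n) => M i j)).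
  exact: cf.
exact: coord_continuous.
Qed.

Lemma continuous_mx (T : topologicalType) m n (f : T -> 'M[R]_(m, n)) :
  (forall i j, continuous (fun t => f t i j)) -> continuous f.
Proof.
move=> cf t; apply/cvgrPdist_lt => e e0.
have : \forall u \near t, forall i j, `|f t i j - f u i j| < e.
  apply: filter_forall => i; apply: filter_forall => j.
  by have /cvgrPdist_lt := cf i j t; apply.
apply: filterS => u h.
rewrite [ltLHS]/Num.norm/= mx_normrE; apply/bigmax_ltP; split => // -[i j] _ /=.
by rewrite !mxE.
Qed.

Lemma continuous_addmx (T : topologicalType) m n (f g : T -> 'M[R]_(m, n)) :
  continuous f -> continuous g -> continuous (fun t => f t + g t).
Proof.
move=> cf cg; apply: continuous_mx => i j; under eq_fun do rewrite mxE.
by apply: continuous_addf; exact: continuous_coord.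
Qed.

Lemma continuous_mulmx (T : topologicalType) m n p
    (f : T -> 'M[R]_(m, n)) (g : T -> 'M[R]_(n, p)) :
  continuous f -> continuous g -> continuous (fun t => f t *m g t).
Proof.
move=> cf cg; apply: continuous_mx => i j.
under eq_fun do rewrite mxE.
apply: continuous_sum => k.
by apply: continuous_mulf; exact: continuous_coord.
Qed.

Lemma continuous_dot (T : topologicalType) n (f g : T -> 'cV[R]_n) :
  continuous f -> continuous g -> continuous (fun t => dot (f t) (g t)).
Proof.
move=> cf cg; apply: continuous_sum => i.
by apply: continuous_mulf; exact: continuous_coord.
Qed.

Lemma continuous_det (T : topologicalType) n (f : T -> 'M[R]_n) :
  continuous f -> continuous (fun t => \det (f t)).
Proof.
move=> cf; apply: continuous_sum => s.
apply: continuous_mulf; first exact: cst_continuous.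
by apply: continuous_prod => i; exact: continuous_coord.
Qed.

Lemma mx_norm_leP m n (M : 'M[R]_(m, n)) b : 0 <= b ->
  `|M| <= b <-> forall i j, `|M i j| <= b.
Proof.
move=> b0; rewrite {1}/Num.norm/= mx_normrE; split.
  by move=> /bigmax_leP[_ h] i j; exact: (h (i, j)).
by move=> h; apply/bigmax_leP; split => // -[i j] _; exact: h.
Qed.

(** Heine-Borel for matrices: transfer of Tychonoff's theorem for row vectors
    along the reshaping of rows into matrices. *)
Lemma box_closed_compact m n (b : R) (A : set 'M[R]_(m, n)) :
  closed A -> (forall M, A M -> forall i j, `|M i j| <= b) -> compact A.
Proof.
move=> Acl Ab.
pose B := [set v : 'rV[R]_(m * n) | forall i, `[- b, b]%classic (v ord0 i)].
have cB : compact B.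
  by apply: (@rV_compact _ _ (fun=> `[- b, b]%classic)) => _; exact: segment_compact.
apply: (@subclosed_compact _ _ (vec_mx @` B)) => //.
  apply: continuous_compact => //; apply: continuous_subspaceT.
  apply: continuous_mx => i j; under eq_fun do rewrite mxE.
  exact: coord_continuous.
move=> M AM; exists (mxvec M); last exact: mxvecK.
move=> k /=; case/mxvec_indexP: k => i j; rewrite mxvecE in_itv/= -ler_norml.
exact: Ab.
Qed.

Lemma closed_sublevel (T : topologicalType) (f : T -> R) (b : R) :
  continuous f -> closed [set t | f t <= b].
Proof.
move=> cf; apply: (@preimage_closed _ _ f [set x | x <= b]).
  by move=> t _; exact: cf.
exact: closed_le.
Qed.

Lemma compact_coord_bounded m n (A : set 'M[R]_(m, n)) : compact A ->
  exists2 b : R, 0 < b & forall M, A M -> forall i j, `|M i j| <= b.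
Proof.
move=> /compact_bounded [b [_ /(_ (`|b| + 1))]] h.
exists (`|b| + 1); first by rewrite ltr_wpDl.
move=> M AM; apply/mx_norm_leP; first by rewrite addr_ge0.
by apply: h => //; rewrite (le_lt_trans (ler_norm b))// ltrDl.
Qed.

End Topology.
(** * Separation from a compact convex set *)

Lemma ler_vanishing (R : realType) (a b c : R) :
  (forall t, 0 < t -> t <= 1 -> a <= b + t * c) -> a <= b.
Proof.
move=> h; have [c0|c0] := leP c 0.
  by have := h 1 ltr01 (lexx _); lra.
apply/ler_addgt0Pr => e e0.
have t0 : 0 < Num.min 1 (e / c) by rewrite lt_min ltr01 divr_gt0.
apply: le_trans (h _ t0 _) _; first by rewrite ge_min lexx.
by rewrite lerD2l -ler_pdivlMr// ge_min lexx orbT.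
Qed.

Section Polar.
Context {R : realType} {n : nat}.
Implicit Types (L : set 'cV[R]_n) (x y : 'cV[R]_n).

(** Along the segment from [x0] to [x], the squared distance to [p] is a
    quadratic function of the parameter that is minimal at 0, so its derivative
    there is nonnegative. *)
Lemma closest_point_obtuse L x0 p :
  (forall x y t, L x -> L y -> 0 <= t -> t <= 1 -> L (x + t *: (y - x))) ->
  L x0 -> (forall x, L x -> dot (x0 - p) (x0 - p) <= dot (x - p) (x - p)) ->
  forall x, L x -> dot (p - x0) x <= dot (p - x0) x0.
Proof.
move=> cvxL Lx0 minx0 x Lx.
rewrite -subr_le0 -dotNr -dotDr -(ler_pM2l (ltr0n R 2)) mulr0.
apply: (@ler_vanishing _ _ _ (dot (x - x0) (x - x0))) => t t0 t1.
have := minx0 _ (cvxL _ _ _ Lx0 Lx (ltW t0) t1).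
rewrite addrAC -(opprB p x0) !(dotDl (- (p - x0))) !(dotDr _ (- (p - x0))).
rewrite !(dotZl, dotZr, dotNl (p - x0), dotNr _ (p - x0)) (dotC (x - x0) (p - x0)).
set a := dot (p - x0) (x - x0); set b := dot (x - x0) _; set c := dot (p - x0) _.
move=> h.
have : 0 <= t * (t * b - 2 * a) by lra.
by rewrite pmulr_rge0 //; lra.
Qed.

(** The half-space bounded by the hyperplane through the point of L closest to
    [p] does not contain [p]; since L contains a neighborhood of 0, the support
    value is positive and can be normalized to 1. *)
Lemma polar_separation L (e : R) p :
  compact L ->
  (forall x y t, L x -> L y -> 0 <= t -> t <= 1 -> L (x + t *: (y - x))) ->
  0 < e -> (forall x, (forall i, `|x i 0| <= e) -> L x) ->
  ~ L p ->
  exists2 y, (forall x, L x -> dot y x <= 1) & 1 < dot y p.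
Proof.
move=> cL cvxL e0 ballL Lp.
have L0 : L 0 by apply: ballL => i; rewrite mxE normr0 ltW.
have [||x0] := @compact_EVT_min _ _ (fun x => dot (x - p) (x - p)) L _ cL.
- by exists 0.
- have csub : continuous (fun x : 'cV[R]_n => x - p).
    apply: continuous_addmx; last exact: cst_continuous.
    by move=> x; exact: cvg_id.
  exact/continuous_subspaceT/continuous_dot.
rewrite inE => Lx0 minx0.
have vx : forall x, L x -> dot (p - x0) x <= dot (p - x0) x0.
  apply: closest_point_obtuse cvxL Lx0 _ => x Lx.
  by apply: minx0; rewrite inE.
set v := p - x0 in vx.
have v0 : v != 0 by apply/eqP => /subr0_eq px0; apply: Lp; rewrite px0.
have vv : 0 < dot v v by rewrite dot_gt0.
have h0 : 0 < dot v x0.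
  have n0 : 0 < `|v| + 1 by rewrite ltr_wpDl.
  apply: lt_le_trans (vx ((e / (`|v| + 1)) *: v) _).
    by rewrite dotZr mulr_gt0// divr_gt0.
  apply: ballL => i; rewrite mxE normrM gtr0_norm ?divr_gt0//.
  rewrite mulrAC ler_pdivrMr// ler_pM2l//.
  apply: (@le_trans _ _ `|v|); last by rewrite lerDl.
  exact: (mx_norm_leP v (normr_ge0 v)).1.
exists ((dot v x0)^-1 *: v).
  by move=> x Lx; rewrite dotZl ler_pdivrMl// mulr1 vx.
by rewrite dotZl ltr_pdivlMl// mulr1 -subr_gt0 -dotNr -dotDr.
Qed.

End Polar.

(** * Rank-one updates *)

Section RankOne.
Context {R : realType} {n : nat}.

(** Both sides are the determinant of the same 2 x 2 block matrix, computed with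
    either diagonal block as pivot. *)
Lemma det_1subC m k (A : 'M[R]_(m, k)) (B : 'M[R]_(k, m)) :
  \det (1%:M - A *m B) = \det (1%:M - B *m A).
Proof.
transitivity (\det (block_mx 1%:M B A 1%:M)).
  have -> : block_mx 1%:M B A 1%:M =
      block_mx 1%:M 0 A 1%:M *m block_mx 1%:M B 0 (1%:M - A *m B).
    by rewrite mulmx_block !(mulmx1, mul1mx, mulmx0, mul0mx, addr0, add0r) addrC subrK.
  by rewrite det_mulmx det_lblock det_ublock !det1 !mul1r.
have -> : block_mx 1%:M B A 1%:M =
    block_mx 1%:M B 0 1%:M *m block_mx (1%:M - B *m A) 0 A 1%:M.
  by rewrite mulmx_block !(mulmx1, mul1mx, mulmx0, mul0mx, addr0, add0r) subrK.
by rewrite det_mulmx det_lblock det_ublock !det1 !mul1r mulr1.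
Qed.

Definition rank1_update (k : R) (u : 'cV[R]_n) : 'M[R]_n :=
  1%:M + k *: (u *m u^T).

Lemma mul_rank1_update k u (x : 'cV[R]_n) :
  rank1_update k u *m x = x + (k * dot u x) *: u.
Proof.
rewrite mulmxDl mul1mx -scalemxAl -mulmxA -scalerA; congr (_ + _ *: _).
apply/matrixP => i j; rewrite ord1 mxE big_ord1 !mxE mulrC /dot.
congr (_ * _).
by apply: eq_bigr => l _; rewrite mxE.
Qed.

Lemma det_rank1_update k u : \det (rank1_update k u) = 1 + k * dot u u.
Proof.
have -> : rank1_update k u = 1%:M - ((- k) *: u) *m u^T.
  by rewrite -scalemxAl scaleNr opprK.
rewrite det_1subC -scalemxAr scaleNr opprK [_ + _]mx11_scalar det_scalar1.
rewrite 3!mxE eqxx; congr (_ + _ * _); rewrite mxE.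
by apply: eq_bigr => i _; rewrite mxE.
Qed.

End RankOne.
(** * Feasible pairs and their maximization *)

Section Extremal.
Context {R : realType} {n : nat}.
Variables (L : set 'cV[R]_n) (s : R).

(** [C^T C] stands for the second moment matrix and [C^T z] for the mean of a
    probability measure on the polar of L.  Parametrizing by [C] and [z] rather
    than by the moments makes every condition polynomial and provides the
    square root of the moment matrix that turns a ball into an ellipsoid. *)
Definition feasible : set ('M[R]_n * 'cV[R]_n) :=
  [set p | dot p.2 p.2 <= 1 /\
    forall x, L x ->
      dot (p.1 *m x) (p.1 *m x) + (s - 1) * dot p.2 (p.1 *m x) <= s].

Lemma feasible_closed : closed feasible.
Proof.
have cfst : continuous (fst : 'M[R]_n * 'cV[R]_n -> _) by move=> p; exact: cvg_fst.
have csnd : continuous (snd : 'M[R]_n * 'cV[R]_n -> _) by move=> p; exact: cvg_snd.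
have -> : feasible = [set p | dot p.2 p.2 <= 1] `&`
    \bigcap_(x in L) [set p |
      dot (p.1 *m x) (p.1 *m x) + (s - 1) * dot p.2 (p.1 *m x) <= s].
  by [].
apply: closedI; first exact/closed_sublevel/continuous_dot.
apply: closed_bigI => x _; apply: closed_sublevel.
have cx : continuous (fun p : 'M[R]_n * 'cV[R]_n => p.1 *m x).
  by apply: continuous_mulmx => //; exact: cst_continuous.
apply: continuous_addf; first exact: continuous_dot.
by apply: continuous_mulf; [exact: cst_continuous | exact: continuous_dot].
Qed.

Hypothesis s_gt0 : 0 < s.

(** For [x] such that L contains [x] and [- x], adding the two conditions
    cancels the linear terms and leaves [|C x|^2 <= s]. *)
Lemma feasible_compact (e : R) : 0 < e ->
  (forall x : 'cV[R]_n, (forall i, `|x i 0| <= e) -> L x) -> compact feasible.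
Proof.
move=> e0 ballL.
pose b := (s + 1) / e + 1.
pose box m := [set M : 'M[R]_(n, m) | forall i j, `|M i j| <= b].
have box_compact m : compact (box m).
  apply: (@box_closed_compact _ _ _ b) => //.
  have -> : box m = \bigcap_(ij in setT) [set M | `|M ij.1 ij.2| <= b].
    by apply/seteqP; split=> M /= h => [ij _|i j]; [exact: h|exact: (h (i, j))].
  apply: closed_bigI => ij _; apply: closed_sublevel.
  by apply: continuous_normf; exact: coord_continuous.
apply: (@subclosed_compact _ _ (box n `*` box 1%N)).
- exact: feasible_closed.
- exact: compact_setX.
move=> [C z] [/= zz Cx]; split=> /= i j.
  pose x : 'cV[R]_n := e *: delta_mx j 0.
  have xL : L x.
    apply: ballL => l; rewrite !mxE andbT.
    case: eqP => _; first by rewrite mulr1 gtr0_norm.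
    by rewrite mulr0 normr0 ltW.
  have xL' : L (- x).
    apply: ballL => l; rewrite !mxE normrN andbT.
    case: eqP => _; first by rewrite mulr1 gtr0_norm.
    by rewrite mulr0 normr0 ltW.
  have CxE : (C *m x) i 0 = e * C i j.
    rewrite -scalemxAr mxE -[delta_mx j 0]/(delta_mx j (0 : 'I_1)) -colE.
    by rewrite mxE.
  have h1 := Cx _ xL; have := Cx _ xL'; rewrite mulmxN !(dotNl, dotNr) opprK => h2.
  have := dot_coord_le (C *m x) i; rewrite CxE => h3.
  rewrite -(ler_pM2l e0) -[X in X * `|_|](gtr0_norm e0) -normrM.
  rewrite mulrDr mulrCA divff ?gt_eqF// mulr1.
  have s1 : 0 <= s + 1 by move: s_gt0; lra.
  apply: (@le_trans _ _ (s + 1)); last by lra.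
  by rewrite -(@ler_pXn2r _ 2)// ?nnegrE// real_normK ?num_real//; nra.
rewrite ord1; apply: (@le_trans _ _ 1).
  rewrite -(@ler_pXn2r _ 2)// ?nnegrE// real_normK ?num_real// expr1n.
  exact: le_trans (dot_coord_le z i) zz.
by rewrite /b lerDr divr_ge0//; move: s_gt0; lra.
Qed.

(** The denominator penalizes a large mean: for [beta = 0] the maximum would yield
    the best ellipsoid centered at the origin, and the weight [beta] is what
    allows the inner ellipsoid to move. *)
Definition objective (beta : R) (p : 'M[R]_n * 'cV[R]_n) : R :=
  \det p.1 ^+ 2 / (1 + beta * dot p.2 p.2) ^+ n.

Lemma objective_max_exists (e b beta : R) : 0 <= beta -> 0 < e ->
  (forall x : 'cV[R]_n, (forall i, `|x i 0| <= e) -> L x) ->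
  (forall x, L x -> dot x x <= b) ->
  exists C z, [/\ feasible (C, z), \det C != 0 &
    forall p, feasible p -> objective beta p <= objective beta (C, z)].
Proof.
move=> beta0 e0 ballL Lb.
have den_gt0 (p : 'M[R]_n * 'cV[R]_n) : 0 < 1 + beta * dot p.2 p.2.
  by rewrite ltr_wpDr// mulr_ge0// dot_ge0.
have b0 : 0 <= b.
  by apply: le_trans (Lb 0 _); [rewrite dot0r | apply: ballL => i; rewrite mxE normr0 ltW].
(* A small multiple of the identity is feasible with a positive objective, so
   the maximum is attained at an invertible matrix. *)
pose d := Num.sqrt (s / (b + 1)).
have d_gt0 : 0 < d by rewrite sqrtr_gt0 divr_gt0//; move: s_gt0; lra.
have F0 : feasible (d%:M, 0).
  split => /=; first by rewrite dot0r.
  move=> x /Lb xb; rewrite mul_scalar_mx dotC dot0r mulr0 addr0 dotZl dotZr mulrA.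
  rewrite -expr2 sqr_sqrtr; last by rewrite divr_ge0//; move: s_gt0; lra.
  rewrite mulrAC ler_pdivrMr ?ler_pM2l//; lra.
have [||[C z]] := @compact_EVT_max _ _ (objective beta) feasible _ (feasible_compact e0 ballL).
- by exists (d%:M, 0).
- apply: continuous_subspaceT; apply: continuous_mulf.
    by apply/continuous_expf/continuous_det => ?; exact: cvg_fst.
  move=> p; apply: cvgV; first by rewrite expf_neq0// gt_eqF.
  apply: (@continuous_expf _ _ (fun p : 'M[R]_n * 'cV[R]_n => 1 + beta * dot p.2 p.2)).
  apply: continuous_addf; first exact: cst_continuous.
  apply: continuous_mulf; first exact: cst_continuous.
  by apply: continuous_dot => ?; exact: cvg_snd.
rewrite inE => FC maxC; exists C, z; split => //; last first.
  by move=> p Fp; apply: maxC; rewrite inE.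
apply/eqP => C0; have := maxC (d%:M, 0); rewrite inE => /(_ F0).
rewrite /objective /= C0 expr0n /= mul0r det_scalar leNgt.
by rewrite divr_gt0// !exprn_gt0// (den_gt0 (d%:M, 0)).
Qed.

End Extremal.

(** * The first-order condition at a maximum *)

Section Optimality.
Context {R : realType} {n : nat}.

Lemma bernoulli_ge0 (t : R) m : 0 <= t -> 1 + m%:R * (t - 1) <= t ^+ m.
Proof.
move=> t0; elim: m => [|m IHm]; first by rewrite mul0r addr0 expr0.
rewrite exprS -natr1.
have tm : 0 <= t * (t ^+ m - (1 + m%:R * (t - 1))) by rewrite mulr_ge0 ?subr_ge0.
have : 0 <= m%:R * (t - 1) ^+ 2 by rewrite mulr_ge0 ?ler0n ?sqr_ge0.
by nra.
Qed.

(** Derivation at [eta = 0] of [(1 + eta e) D^n <= W(eta)^n], where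
    [D = W(0) = 1 + beta a], without calculus: Bernoulli's inequality for
    [(D / W)^n] makes the condition polynomial in [eta], and the terms of
    positive order in [k] are discarded by letting [k] tend to 0.  The mass
    [eta] is given through [k] because [1 + eta e = (1 + k e)^2] then has a
    rational square root. *)
Lemma first_order_condition (a beta e q : R) :
  0 <= beta -> 0 <= e -> 0 <= a ->
  (forall k, 0 < k -> k <= 1 ->
    let eta := k * (2 + k * e) in
    let W := 1 + eta +
      beta * (a + eta * (2 * q + eta * e - q ^+ 2) / (1 + eta * e)) in
    0 < W /\ (1 + eta * e) * (1 + beta * a) ^+ n <= W ^+ n) ->
  e * (1 + beta * a) <= n%:R * (1 + 2 * beta * q - beta * q ^+ 2).
Proof.
move=> beta0 e0 a0 h.
pose c := (2 + e) * (n%:R * e * (1 + beta) + e * beta * (1 + 2 * q ^+ 2)).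
apply: (@ler_vanishing _ _ _ c) => k k0 k1.
have [] := h _ k0 k1.
set eta := k * (2 + k * e); set W := (X in 0 < X) => W0 hW.
have ke0 : 0 <= k * e by rewrite mulr_ge0// ltW.
have eta0 : 0 < eta by rewrite mulr_gt0//; lra.
have eta_le : eta <= k * (2 + e) by rewrite ler_pM2l// lerD2l ler_piMl.
have etae0 : 0 <= eta * e by rewrite mulr_ge0// ltW.
have etae_gt0 : 0 < 1 + eta * e by lra.
pose D := 1 + beta * a.
have D0 : 0 <= D by rewrite addr_ge0// mulr_ge0.
pose X := 1 + beta * (2 * q + eta * e - q ^+ 2) / (1 + eta * e).
have WE : W = D + eta * X.
  by rewrite /W /D /X; field; rewrite gt_eqF.
have XE : X * (1 + eta * e) =
    1 + 2 * beta * q - beta * q ^+ 2 + eta * e * (1 + beta).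
  by rewrite /X; field; rewrite gt_eqF.
have t0 : 0 <= D / W by rewrite divr_ge0// ltW.
have b1 : (1 + eta * e) * (1 + n%:R * (D / W - 1)) <= 1.
  apply: (@le_trans _ _ ((1 + eta * e) * (D / W) ^+ n)).
    by rewrite ler_pM2l// bernoulli_ge0.
  by rewrite expr_div_n mulrA ler_pdivrMr ?exprn_gt0// mul1r.
have b2 : e * W <= n%:R * (X * (1 + eta * e)).
  have : (1 + eta * e) * (W + n%:R * (D - W)) <= W.
    have -> : W + n%:R * (D - W) = (1 + n%:R * (D / W - 1)) * W.
      by field; rewrite gt_eqF.
    by rewrite mulrA -[leRHS]mul1r ler_pM2r.
  rewrite WE => b3; rewrite -(ler_pM2l eta0) -subr_ge0.
  by move: b3; rewrite -subr_ge0; congr (0 <= _); ring.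
have X_ge : - (beta * (1 + 2 * q ^+ 2)) <= X.
  rewrite /X -mulrA.
  suff : - (1 + 2 * q ^+ 2) <= (2 * q + eta * e - q ^+ 2) / (1 + eta * e).
    move=> /(ler_wpM2l beta0); lra.
  rewrite ler_pdivlMr//.
  have : 0 <= (1 + 2 * q ^+ 2) * (eta * e).
    by rewrite mulr_ge0// addr_ge0// mulr_ge0// sqr_ge0.
  have := sqr_ge0 (q + 1); nra.
have b4 : e * D <= e * W + eta * (e * beta * (1 + 2 * q ^+ 2)).
  rewrite WE; have : 0 <= e * eta * (X + beta * (1 + 2 * q ^+ 2)).
    by rewrite !mulr_ge0// ?(ltW eta0)//; lra.
  by lra.
have c0 : 0 <= n%:R * e * (1 + beta) + e * beta * (1 + 2 * q ^+ 2).
  by rewrite addr_ge0// !mulr_ge0// ?ler0n// addr_ge0// mulr_ge0// sqr_ge0.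
have := ler_wpM2r c0 eta_le.
rewrite -/D /c mulrA; move: b2 b4; rewrite XE.
lra.
Qed.

End Optimality.

(* Adding a mass [eta] at the polar point [C^T u] replaces the moments
   [C^T C] and [C^T z] by [C^T C + eta C^T u u^T C] and [C^T z + eta C^T u].  In
   terms of the square root, the new matrix is [(1 + k u u^T) C] when
   [eta = k (2 + k |u|^2)], and the coefficient in [z'] is the one for which
   [((1 + k u u^T) C)^T z'] is the new mean.  The total mass is [1 + eta], whence
   the normalization by its square root. *)
Section RankOneFeasible.
Context {R : realType} {n : nat}.
Variables (L : set 'cV[R]_n) (s : R) (C : 'M[R]_n) (z u : 'cV[R]_n) (k : R).
Hypothesis k_gt0 : 0 < k.
Hypothesis CzF : feasible L s (C, z).
Hypothesis polar_u : forall x, L x -> - s <= dot u (C *m x) <= 1.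

Let e := dot u u.
Let q := dot u z.
Let a := dot z z.
Let eta := k * (2 + k * e).
Let z' := z + (k * (2 + k * e - q) / (1 + k * e)) *: u.

Let ke_gt0 : 0 < 1 + k * e.
Proof. by rewrite ltr_wpDr// mulr_ge0 ?dot_ge0// ltW. Qed.

Let eta_gt0 : 0 < eta.
Proof. by rewrite mulr_gt0//; move: ke_gt0; lra. Qed.

Lemma sqr_rank1_factor : (1 + k * e) ^+ 2 = 1 + eta * e.
Proof. by rewrite /eta; ring. Qed.

Lemma rank1_moment_norm :
  dot z' z' = a + eta * (2 * q + eta * e - q ^+ 2) / (1 + eta * e).
Proof.
rewrite -sqr_rank1_factor /z' !(dotDl, dotDr, dotZl, dotZr) (dotC z u).
by rewrite -/e -/q -/a /eta; field; rewrite gt_eqF.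
Qed.

(** The bound on [z'] amounts to [(1 - <u,z>)^2 >= 0], and the bound on L to
    [(1 - <u, C x>) (s + <u, C x>) >= 0]. *)
Lemma rank1_feasible : let nu := (Num.sqrt (1 + eta))^-1 in
  feasible L s (nu *: (rank1_update k u *m C), nu *: z').
Proof.
move=> nu.
have N0 : 0 < 1 + eta by move: eta_gt0; lra.
have nu2 : nu * nu = (1 + eta)^-1.
  by rewrite -invfM -expr2 sqr_sqrtr// ltW.
have [/= za Cx] := CzF.
split=> /=.
  rewrite dotZl dotZr mulrA nu2 rank1_moment_norm ler_pdivrMl// mulr1.
  rewrite -sqr_rank1_factor -subr_ge0.
  have -> : 1 + eta - (a + eta * (2 * q + eta * e - q ^+ 2) / (1 + k * e) ^+ 2)
     = (1 - a) + eta * (1 - q) ^+ 2 / (1 + k * e) ^+ 2.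
    by rewrite /eta; field; rewrite gt_eqF.
  by rewrite addr_ge0 ?subr_ge0// divr_ge0// ?sqr_ge0// mulr_ge0 ?sqr_ge0// ltW.
move=> x Lx; have := Cx _ Lx; have := polar_u Lx.
rewrite -scalemxAl -mulmxA mul_rank1_update.
set y := C *m x => /andP[p1 p2] hx.
rewrite !(dotZl, dotZr) !mulrA nu2.
have -> : dot z' (y + (k * dot u y) *: u) = dot z y + eta * dot u y.
  rewrite /z' !(dotDl, dotDr, dotZl, dotZr) (dotC z u) -/e -/q /eta.
  by field; rewrite gt_eqF.
have -> : dot (y + (k * dot u y) *: u) (y + (k * dot u y) *: u) =
    dot y y + eta * dot u y ^+ 2.
  rewrite !(dotDl, dotDr, dotZl, dotZr) (dotC y u) -/e /eta; ring.
rewrite -[(s - 1) * nu * nu]mulrA nu2.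
have -> : (1 + eta)^-1 * (dot y y + eta * dot u y ^+ 2) +
   (s - 1) * (1 + eta)^-1 * (dot z y + eta * dot u y) =
   ((dot y y + (s - 1) * dot z y) +
     eta * (dot u y ^+ 2 + (s - 1) * dot u y)) / (1 + eta).
  by field; rewrite gt_eqF.
rewrite ler_pdivrMr// [s * _]mulrDr mulr1 lerD// (mulrC s) ler_pM2l//.
have : 0 <= (1 - dot u y) * (s + dot u y) by rewrite mulr_ge0//; lra.
by lra.
Qed.

End RankOneFeasible.

Section MaximalPair.
Context {R : realType} {n : nat}.

(** Maximality against the normalized rank-one updates, for which the powers of
    the total mass in the determinant and in the denominator cancel. *)
Lemma maximal_pair_polar (L : set 'cV[R]_n) (s beta : R) C z u :
  0 <= beta -> feasible L s (C, z) -> \det C != 0 ->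
  (forall p, feasible L s p -> objective beta p <= objective beta (C, z)) ->
  (forall x, L x -> - s <= dot u (C *m x) <= 1) ->
  dot u u * (1 + beta * dot z z) <=
    n%:R * (1 + 2 * beta * dot u z - beta * dot u z ^+ 2).
Proof.
move=> beta0 CzF C0 maxCz polar_u.
apply: first_order_condition => //; [exact: dot_ge0|exact: dot_ge0|].
move=> k k0 _ eta W.
have e0 := dot_ge0 u.
have ke0 : 0 < 1 + k * dot u u by rewrite ltr_wpDr// mulr_ge0// ltW.
have eta0 : 0 < eta by rewrite mulr_gt0//; lra.
have N0 : 0 < 1 + eta by lra.
have := rank1_feasible k0 CzF polar_u; have := rank1_moment_norm z u k0.
rewrite -/eta; set z' := z + _; set nu := (Num.sqrt _)^-1 => zE /maxCz.
have nu2 : nu ^+ 2 = (1 + eta)^-1 by rewrite exprVn sqr_sqrtr// ltW.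
have W0 : 0 < W by rewrite ltr_wpDr// mulr_ge0// -zE dot_ge0.
have D0 : 0 < 1 + beta * dot z z by rewrite ltr_wpDr// mulr_ge0// dot_ge0.
have det2 : 0 < \det C ^+ 2 by rewrite lt_def sqr_ge0 sqrf_eq0 C0.
have detE : \det (nu *: (rank1_update k u *m C)) ^+ 2 =
    ((1 + eta)^-1) ^+ n * ((1 + eta * dot u u) * \det C ^+ 2).
  rewrite detZ det_mulmx det_rank1_update !exprMn sqr_rank1_factor -nu2.
  by rewrite -!exprM (mulnC n).
have normE : 1 + beta * dot (nu *: z') (nu *: z') = W / (1 + eta).
  rewrite dotZl dotZr [nu * (nu * _)]mulrA -expr2 nu2 zE /W.
  by field; rewrite !gt_eqF//; nra.
rewrite /objective /= detE normE => h; split=> //.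
move: h; rewrite ler_pdivrMr ?exprn_gt0 ?divr_gt0// expr_div_n exprVn.
rewrite [leRHS]mulrA [leRHS]mulrC ler_pM2l ?invr_gt0 ?exprn_gt0//.
rewrite [leRHS]mulrAC ler_pdivlMr ?exprn_gt0// mulrAC [leRHS]mulrC.
by rewrite ler_pM2r.
Qed.

End MaximalPair.

(** * Homothetic ellipsoids inside and around a body *)

Section EllipsoidPosition.
Context {R : realType} {n : nat}.
Hypothesis n_gt0 : (0 < n)%N.

(** Completing the square in the feasibility condition puts [C x] in the ball of
    radius [rho r] around [- (s - 1) / 2 z]; the polar estimate puts the ball of
    radius [r] around [- beta z] inside the image of L under [C]. *)
Lemma ellipsoid_position (L : set 'cV[R]_n) (s e : R) :
  0 < s -> compact L ->
  (forall x y t, L x -> L y -> 0 <= t -> t <= 1 -> L (x + t *: (y - x))) ->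
  0 < e -> (forall x : 'cV[R]_n, (forall i, `|x i 0| <= e) -> L x) ->
  (forall x, L x -> L (- (s^-1 *: x))) ->
  exists (A : 'M[R]_n) (u v : 'cV[R]_n),
    [/\ A \in unitmx,
        [set u + x | x in L] `<=` [set A *m y | y in @euclidean_ball R n] &
        [set A *m y | y in @euclidean_ball R n] `<=`
          [set v + Num.sqrt (n%:R * s) *: x | x in L]].
Proof.
move=> s0 cL cvxL e0 ballL reflL.
have n0 : 0 < n%:R :> R by rewrite ltr0n.
have [b b0 Lb] := compact_coord_bounded cL.
(* The choice of beta for which the ratio of the radii is independent of z,
   see R2 below. *)
pose beta := (s - 1) ^+ 2 / (4 * s).
have beta0 : 0 <= beta by rewrite divr_ge0 ?sqr_ge0//; lra.
have [|C [z [CzF C0 maxCz]]] :=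
    @objective_max_exists _ _ L s s0 e (\sum_(i < n) b ^+ 2) beta beta0 e0 ballL.
  move=> x Lx; rewrite dot_sqr; apply: ler_sum => i _.
  by rewrite -real_normK ?num_real// lerXn2r ?nnegrE// ?(ltW b0)// Lb.
have Cunit : C \in unitmx by rewrite unitmxE unitfE.
have polarL u : (forall x, L x -> dot u (C *m x) <= 1) ->
    forall x, L x -> - s <= dot u (C *m x) <= 1.
  move=> ule x Lx; rewrite ule// andbT.
  have := ule _ (reflL _ Lx).
  by rewrite mulmxN -scalemxAr dotNr dotZr lerNl ler_pdivlMl// mulrN1.
have Cz u uL := maximal_pair_polar beta0 CzF C0 maxCz (polarL u uL).
have [/= zle Cx] := CzF.
set a := dot z z in Cz zle.
pose D := 1 + beta * a.
have D0 : 0 < D by rewrite ltr_wpDr// mulr_ge0// dot_ge0.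
pose rho := Num.sqrt (n%:R * s).
pose r := Num.sqrt (D / n%:R).
have rho0 : 0 < rho by rewrite sqrtr_gt0 mulr_gt0.
have r0 : 0 < r by rewrite sqrtr_gt0 divr_gt0.
have r2 : r ^+ 2 = D / n%:R by rewrite sqr_sqrtr// ltW// divr_gt0.
have rho2 : rho ^+ 2 = n%:R * s by rewrite sqr_sqrtr// ltW// mulr_gt0.
have R2 : (rho * r) ^+ 2 = s + (s - 1) ^+ 2 / 4 * a.
  by rewrite exprMn r2 rho2 /D /beta; field; rewrite !gt_eqF.
have R0 : 0 < rho * r by rewrite mulr_gt0.
exists ((rho * r) *: invmx C), (invmx C *m (((s - 1) / 2) *: z)),
  ((rho * beta) *: (invmx C *m z)); split.
- by rewrite unitmxZ ?unitmx_inv// unitfE gt_eqF.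
- move=> _ [x Lx <-]; exists ((rho * r)^-1 *: (C *m x + ((s - 1) / 2) *: z)).
    apply/in_euclidean_ball; rewrite dotZl dotZr mulrA -expr2 exprVn.
    rewrite ler_pdivrMl ?exprn_gt0// mulr1 R2.
    rewrite !(dotDl, dotDr, dotZl, dotZr) (dotC (C *m x) z) -/a.
    by have := Cx _ Lx; lra.
  rewrite -scalemxAl -scalemxAr scalerA divff ?gt_eqF// scale1r mulmxDr.
  by rewrite mulKmx// addrC.
move=> _ [y /in_euclidean_ball yball <-].
exists (invmx C *m (r *: y - beta *: z)); last first.
  rewrite mulmxBr -!scalemxAr -scalemxAl scalerBr !scalerA.
  by rewrite addrC subrK.
apply: contrapT => /(polar_separation cL cvxL e0 ballL)[w wL wp].
pose u := (invmx C)^T *m w.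
have uE x : dot u x = dot w (invmx C *m x) by rewrite dot_mulmxl trmxK.
move: wp; rewrite -uE; apply/negP; rewrite -leNgt.
have uL x : L x -> dot u (C *m x) <= 1.
  by move=> Lx; rewrite uE mulKmx// wL.
have := Cz u uL; rewrite dotDr dotNr !dotZr -/D; set q := dot u z => uu.
have uu0 : 0 <= dot u u * D by rewrite mulr_ge0 ?dot_ge0// ltW.
have q1 : 0 <= 1 + 2 * beta * q - beta * q ^+ 2.
  by rewrite -(pmulr_rge0 _ n0); exact: le_trans uu0 uu.
have bq2 : 0 <= beta * q ^+ 2 by rewrite mulr_ge0 ?sqr_ge0.
(* [1 + beta q >= 0] because [1 + 2 beta q >= 0] by q1 and bq2. *)
rewrite lerBlDr; apply: (@le_trans _ _ `|1 + beta * q|); last first.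
  by rewrite ger0_norm//; lra.
apply: le_trans (ler_norm _) _.
rewrite -(@ler_pXn2r _ 2)// ?nnegrE// !real_normK ?num_real//.
apply: (@le_trans _ _ (1 + 2 * beta * q - beta * q ^+ 2)); last first.
  by have := sqr_ge0 (beta * q); lra.
rewrite exprMn r2 mulrAC ler_pdivrMr// mulrC [leRHS]mulrC.
apply: le_trans uu; rewrite ler_pM2r//.
apply: le_trans (dot_CauchySchwarz _ _) _.
by rewrite -[leRHS]mulr1 ler_wpM2l// dot_ge0.
Qed.

End EllipsoidPosition.

(** * The upper bound *)

Section UpperBound.
Context {R : realType} {n : nat}.
Implicit Types K : set 'cV[R]_n.

Definition asymmetry_ratio K (rho : R) : Prop :=
  0 <= rho /\ exists c : 'cV[R]_n,
    [set x - c | x in K] `<=` [set rho *: (c - x) | x in K].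

Definition bm_ratio (K L : set 'cV[R]_n) (rho : R) : Prop :=
  0 <= rho /\
    exists (A : 'M[R]_n) (u v : 'cV[R]_n),
      [/\ A \in unitmx,
          [set u + x | x in K] `<=` [set A *m y | y in L] &
          [set A *m y | y in L] `<=` [set v + rho *: x | x in K]].

Lemma convex_set_segment K : convex_set K -> forall x y t,
  K x -> K y -> 0 <= t -> t <= 1 -> K (x + t *: (y - x)).
Proof.
move=> cvxK x y t Kx Ky t0 t1.
have -> : x + t *: (y - x) = t *: y + (1 - t) *: x.
  by rewrite scalerBl scale1r scalerBr addrCA.
by have := cvxK y x (Itv01 t0 t1); rewrite !inE; exact.
Qed.

Lemma interior_box K (p : 'cV[R]_n) : interior K p ->
  exists2 e : R, 0 < e & forall x : 'cV[R]_n, (forall i, `|x i 0 - p i 0| <= e) -> K x.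
Proof.
move=> /nbhs_ballP[e /= e0 pK]; exists (e / 2); first by rewrite divr_gt0.
move=> x xp; apply: pK; rewrite -ball_normE /= (@le_lt_trans _ _ (e / 2))//.
  apply/mx_norm_leP; first by rewrite ltW// divr_gt0.
  by move=> i j; rewrite ord1 !mxE distrC.
by rewrite ltr_pdivrMr// ltr_pMr// ltr1n.
Qed.

(** With a box of radius [e] around [p] inside K and the coordinates of K bounded
    by [b], the reflection of K in [p], shrunk by [2 b / e], fits in the box. *)
Lemma asymmetry_ratio_exists K : convex_body K -> exists rho, asymmetry_ratio K rho.
Proof.
move=> [cK _ [p /interior_box [e e0 boxK]]].
have [b b0 Kb] := compact_coord_bounded cK.
have Kp : K p by apply: boxK => i; rewrite subrr normr0 ltW.
have r0 : 0 < 2 * b / e by rewrite divr_gt0// mulr_gt0.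
exists (2 * b / e); split; first exact: ltW.
exists p => _ [x Kx <-]; exists (p - (2 * b / e)^-1 *: (x - p)).
  apply: boxK => i; rewrite !mxE addrAC subrr sub0r normrN normrM normfV.
  rewrite (gtr0_norm r0) ler_pdivrMl// divfK ?gt_eqF//.
  by rewrite (le_trans (ler_normB _ _))// (mulr_natl b) mulr2n lerD// Kb.
by rewrite opprB addrC subrK scalerA divff ?gt_eqF// scale1r.
Qed.

Hypothesis n_gt0 : (0 < n)%N.

(** For [rho = 0] the body would be the single point [c]; in positive dimension
    a box contains more than one point. *)
Lemma asymmetry_ratio_gt0 K rho : convex_body K -> asymmetry_ratio K rho -> 0 < rho.
Proof.
move=> [_ _ [p /interior_box [e e0 boxK]]] [rho0 [c Kc]].
rewrite lt_def rho0 andbT; apply/eqP => rhoE.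
have Kxc x : K x -> x = c.
  move=> Kx; have [|y _] := Kc (x - c); first by exists x.
  by rewrite rhoE scale0r => /esym/subr0_eq.
have pc : p = c by apply: Kxc; apply: boxK => i; rewrite subrr normr0 ltW.
have : p + const_mx e = c.
  apply: Kxc; apply: boxK => i.
  by rewrite !mxE addrAC subrr add0r gtr0_norm.
rewrite pc => /(congr1 (fun x : 'cV[R]_n => x (Ordinal n_gt0) 0)).
by rewrite !mxE; lra.
Qed.

Lemma bm_ratio_of_asymmetry K rho : convex_body K -> asymmetry_ratio K rho ->
  bm_ratio K (@euclidean_ball R n) (Num.sqrt (n%:R * rho)).
Proof.
move=> Kbody Krho; split; first exact: sqrtr_ge0.
have rho0 := asymmetry_ratio_gt0 Kbody Krho.
case: Kbody Krho => cK /convex_set_segment cvxK [p /interior_box[e e0 boxK]].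
move=> [_ [c Kc]].
pose L := [set x - c | x in K].
have LE x : L x <-> K (x + c).
  split=> [[y Ky <-]|Kx]; first by rewrite subrK.
  by exists (x + c) => //; rewrite addrK.
have reflL x : L x -> L (- (rho^-1 *: x)).
  move=> /Kc[y Ky <-]; rewrite scalerA mulVf ?gt_eqF// scale1r opprB.
  by exists y.
have cvxL x y t : L x -> L y -> 0 <= t -> t <= 1 -> L (x + t *: (y - x)).
  move=> [x' Kx <-] [y' Ky <-] t0 t1; exists (x' + t *: (y' - x')).
    exact: cvxK.
  by rewrite opprB addrA subrK addrAC.
have cL : compact L.
  apply: continuous_compact => //; apply: continuous_subspaceT.
  apply: continuous_addmx; last exact: cst_continuous.
  by move=> x; exact: cvg_id.
(* The origin is the convex combination, with weights 1 and rho, of [p - c] and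
   of its reflection [- (p - c) / rho]; the boxes around them combine likewise. *)
have e0' : 0 < 2 * e / (1 + rho) by rewrite divr_gt0 ?mulr_gt0//; lra.
have r1 : 0 < 1 + rho by lra.
have ballL (w : 'cV[R]_n) : (forall i, `|w i 0| <= 2 * e / (1 + rho)) -> L w.
  move=> we; pose d := ((1 + rho) / 2) *: w.
  have dK (k : R) : `|k| = 1 -> K (p + k *: d).
    move=> k1; apply: boxK => i; rewrite !mxE addrAC subrr add0r normrM k1 mul1r.
    rewrite normrM gtr0_norm ?divr_gt0//.
    have := we i; rewrite ler_pdivlMr//; lra.
  have L1 : L (p + 1 *: d - c) by rewrite LE subrK; apply: dK; rewrite normr1.
  have L2 : L (p + (- 1) *: d - c) by rewrite LE subrK; apply: dK; rewrite normrN1.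
  have := cvxL _ _ (rho / (1 + rho)) L1 (reflL _ L2).
  rewrite ler_pdivrMr// mul1r divr_ge0 ?(ltW r1) ?(ltW rho0)// => /(_ isT).
  have -> : rho <= 1 + rho by lra.
  move=> /(_ isT); congr (L _).
  apply/matrixP => i j; rewrite /d !mxE; field.
  by rewrite !gt_eqF.
have [A [u [v [Au Lin Lout]]]] :=
  ellipsoid_position n_gt0 rho0 cL cvxL e0' ballL reflL.
exists A, (u - c), (v - Num.sqrt (n%:R * rho) *: c); split => //.
  move=> _ [x Kx <-]; apply: Lin; exists (x - c); first by exists x.
  by rewrite addrA addrAC.
move=> x /Lout [_ [y Ky <-] <-]; exists y => //.
by rewrite scalerBr addrA addrAC.
Qed.

Lemma banach_mazur_le K rho : bm_ratio K (@euclidean_ball R n) rho ->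
  banach_mazur_distance K (@euclidean_ball R n) <= rho.
Proof. by move=> h; apply: ge_inf => //; exists 0 => t []. Qed.

Lemma ler_sqrt_approx (d x m : R) : 0 <= m ->
  (forall e, 0 < e -> d <= Num.sqrt (m * (x + e))) -> d <= Num.sqrt (m * x).
Proof.
move=> m0 h; have [d0|d0] := leP d 0; first exact: le_trans (sqrtr_ge0 _).
have hx : d ^+ 2 <= m * x.
  apply: (@ler_vanishing _ _ _ m) => t t0 _.
  have dt := h t t0.
  have p0 : 0 < m * (x + t) by rewrite -sqrtr_gt0; exact: lt_le_trans d0 dt.
  rewrite (mulrC t) -mulrDr -(sqr_sqrtr (ltW p0)).
  by rewrite lerXn2r ?nnegrE ?sqrtr_ge0 ?(ltW d0).
by rewrite -(ger0_norm (ltW d0)) -sqrtr_sqr ler_wsqrtr.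
Qed.

Lemma banach_mazur_ball_le K : convex_body K ->
  banach_mazur_distance K (@euclidean_ball R n)
    <= Num.sqrt (n%:R * minkowski_asymmetry K).
Proof.
move=> Kbody; apply: ler_sqrt_approx => // e e0.
have [] := @inf_adherent R (asymmetry_ratio K) e e0.
  by split; [exact: asymmetry_ratio_exists | exists 0 => t []].
move=> rho Krho rho_lt.
apply: le_trans (banach_mazur_le (bm_ratio_of_asymmetry Kbody Krho)) _.
by rewrite ler_wsqrtr// ler_wpM2l// ltW.
Qed.

End UpperBound.

(** * Products of simplices *)

Section SimplexProduct.
Context {R : realType} {k s : nat}.
Hypothesis s_gt0 : (0 < s)%N.
Implicit Types (b : 'I_k) (l : 'I_s) (j : 'I_s.+1) (x y : 'cV[R]_(k * s)).

(** The coordinates of a point of the product are indexed by a block [b] and a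
    position [l] in the block. *)
Definition block_col (F : 'I_k -> 'I_s -> R) : 'cV[R]_(k * s) :=
  (mxvec (\matrix_(b, l) F b l))^T.

Lemma block_colE F b l : block_col F (mxvec_index b l) 0 = F b l.
Proof. by rewrite mxE mxvecE mxE. Qed.

Lemma block_colP x y :
  (forall b l, x (mxvec_index b l) 0 = y (mxvec_index b l) 0) -> x = y.
Proof.
by move=> h; apply/matrixP => i i0; rewrite ord1; case/mxvec_indexP: i.
Qed.

Lemma dot_blocks x y :
  dot x y = \sum_b \sum_l x (mxvec_index b l) 0 * y (mxvec_index b l) 0.
Proof.
rewrite pair_bigA /dot (reindex _ (curry_mxvec_bij _ _)) /=.
by apply: eq_bigr => -[b l] _.
Qed.

(** Each factor is the simplex [x_l >= - 1, \sum_l x_l <= 1]: its centroid is 0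
    and all its facets have support value 1.  Facet 0 is [\sum_l x_l = 1], facet
    [l + 1] is [x_l = - 1], and [vertex b j] is the vertex opposite to facet [j],
    with zero coordinates in the other blocks. *)
Definition normal b j : 'cV[R]_(k * s) := block_col (fun b' l =>
  (b' == b)%:R * ((j == ord0)%:R - (j == lift ord0 l)%:R)).

Definition vertex b j : 'cV[R]_(k * s) := block_col (fun b' l =>
  (b' == b)%:R * (s.+1%:R * (j == lift ord0 l)%:R - 1)).

Lemma sum_delta (I : finType) (i0 : I) : \sum_i (i == i0)%:R = 1 :> R.
Proof.
rewrite (bigD1 i0)//= eqxx big1 ?addr0// => i; by move=> /negPf ->.
Qed.

Lemma sum_delta_lift j : \sum_l (j == lift ord0 l)%:R = (j != ord0)%:R :> R.
Proof.
have := sum_delta j; rewrite big_ord_recl eq_sym.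
under eq_bigr do rewrite eq_sym.
by case: (j == ord0) => /= /eqP; [rewrite -subr_eq0 addrAC subrr add0r|rewrite add0r] => /eqP.
Qed.

Lemma sum_normal b : \sum_j normal b j = 0.
Proof.
apply: block_colP => b' l; rewrite summxE mxE.
under eq_bigr do rewrite block_colE.
by rewrite -mulr_sumr sumrB !sum_delta subrr mulr0.
Qed.

Lemma sum_vertex b : \sum_j vertex b j = 0.
Proof.
apply: block_colP => b' l; rewrite summxE mxE.
under eq_bigr do rewrite block_colE.
by rewrite -mulr_sumr sumrB -mulr_sumr sum_delta sumr_const card_ord mulr1 subrr mulr0.
Qed.

Lemma dot_normal_vertex b j b' j' : dot (normal b j) (vertex b' j') =
  (b == b')%:R * (1 - s.+1%:R * (j == j')%:R).
Proof.
rewrite dot_blocks (bigD1 b)//= [X in _ + X]big1 ?addr0; last first.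
  move=> b'' /negPf b''b; apply: big1 => l _.
  by rewrite !block_colE b''b mul0r mul0r.
under eq_bigr do rewrite !block_colE eqxx mul1r mulrCA.
rewrite -mulr_sumr; congr (_ * _).
pose t (i : 'I_s.+1) l : R := (i == lift ord0 l)%:R.
transitivity (\sum_l (s.+1%:R * (j == ord0)%:R * t j' l - (j == ord0)%:R
                      - s.+1%:R * (j == j')%:R * t j l + t j l)).
  apply: eq_bigr => l _; rewrite /t.
  rewrite -[s.+1%:R * (j == j')%:R * _]mulrA.
  have -> : (j == j')%:R * (j == lift ord0 l)%:R =
     (j == lift ord0 l)%:R * (j' == lift ord0 l)%:R :> R.
    case: (eqVneq j (lift ord0 l)) => [->|_]; last by rewrite mulr0 mul0r.
    by rewrite eq_sym mul1r mulr1.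
  ring.
rewrite big_split sumrB sumrB -!mulr_sumr /= !sum_delta_lift sumr_const card_ord.
rewrite -[(_ == _)%:R *+ s]mulr_natr -natr1.
have [<-|jj'] := eqVneq j j'; have [j0|_] := eqVneq j ord0; rewrite /=; try ring.
have -> : (j' != ord0) by rewrite -j0 eq_sym.
by rewrite /=; ring.
Qed.

Definition simplex_product : set 'cV[R]_(k * s) :=
  [set x | forall b j, dot (normal b j) x <= 1].

(** The normals of a block sum to zero, and the s other ones take values at most
    1. *)
Lemma normal_ge x b j : simplex_product x -> - s%:R <= dot (normal b j) x.
Proof.
move=> Kx; have : \sum_j dot (normal b j) x = 0.
  under eq_bigr do rewrite dotC.
  by rewrite -dot_sumr sum_normal dot0r.
rewrite (bigD1 j)//= => /eqP; rewrite addr_eq0 => /eqP ->; rewrite lerN2.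
apply: (@le_trans _ _ (\sum_(i < s.+1 | i != j) 1)).
  by apply: ler_sum => i _; exact: Kx.
by rewrite sumr_const cardC1 card_ord.
Qed.

Lemma vertex_in_simplex_product (f : 'I_k -> 'I_s.+1) b j :
  dot (normal b j) (\sum_b' vertex b' (f b')) =
    1 - s.+1%:R * (j == f b)%:R.
Proof.
rewrite dot_sumr (bigD1 b)//= dot_normal_vertex eqxx mul1r big1 ?addr0//.
by move=> b' b'b; rewrite dot_normal_vertex eq_sym (negPf b'b) mul0r.
Qed.

Lemma sum_vertices_in (f : 'I_k -> 'I_s.+1) :
  simplex_product (\sum_b vertex b (f b)).
Proof.
move=> b j; rewrite vertex_in_simplex_product.
by rewrite gerBl mulr_ge0// ler0n.
Qed.

Lemma simplex_product_body : convex_body simplex_product.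
Proof.
split.
- apply: (@box_closed_compact _ _ _ s%:R).
    have -> : simplex_product = \bigcap_(bj in setT) [set x |
        dot (normal bj.1 bj.2) x <= 1].
      by apply/seteqP; split=> x /= h => [bj _|b j]; [exact: h|exact: (h (b, j))].
    apply: closed_bigI => bj _; apply: closed_sublevel.
    apply: continuous_dot; first exact: cst_continuous.
    by move=> x; exact: cvg_id.
  move=> x Kx i i0; rewrite ord1; case/mxvec_indexP: i => b l.
  have xE : dot (normal b (lift ord0 l)) x = - x (mxvec_index b l) 0.
    rewrite dot_blocks (bigD1 b)//= [X in _ + X]big1 ?addr0; last first.
      move=> b' /negPf b'b; apply: big1 => l' _.
      by rewrite !block_colE b'b !mul0r.
    rewrite (bigD1 l)//= [X in _ + X]big1 ?addr0; last first.
      move=> l' /negPf l'l; rewrite block_colE (inj_eq lift_inj) [l == l']eq_sym l'l.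
      by rewrite subrr mulr0 mul0r.
    by rewrite block_colE !eqxx sub0r mulrN1 mulN1r.
  have := normal_ge b (lift ord0 l) Kx; have := Kx b (lift ord0 l).
  rewrite xE lerN2 => h1 h2; rewrite ler_norml h2 andbT lerNl.
  by apply: le_trans h1 _; rewrite ler1n.
- move=> x y t; rewrite !inE => Kx Ky b j.
  change (dot (normal b j) (t%:num *: x + (1 - t%:num) *: y) <= 1).
  rewrite dotDr !dotZr.
  have t0 : 0 <= t%:num by [].
  have t1 : t%:num <= 1 by [].
  have := ler_wpM2l t0 (Kx b j).
  have := ler_wpM2l (_ : 0 <= 1 - t%:num) (Ky b j); rewrite subr_ge0 => /(_ t1).
  lra.
exists 0.
have /= := @near_forall_lt R 'cV[R]_(k * s) _
  (fun bj x => dot (normal bj.1 bj.2) x) 1 0 _ _.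
move=> /(_ _ _)/filterS; apply => [x h b j|bj|bj].
- exact/ltW/(h (b, j)).
- apply: continuous_dot; first exact: cst_continuous.
  by move=> x; exact: cvg_id.
- by rewrite dot0r.
Qed.

End SimplexProduct.

(** * Sharpness *)

Section Averaging.
Context {R : realType} {n : nat}.

(** Equality holds on average over [j], the cross terms summing to zero. *)
Lemma exists_far_translate (J : finType) (j0 : J) (S : 'cV[R]_n) (a : J -> 'cV[R]_n) :
  \sum_j a j = 0 ->
  exists j, dot S S + (\sum_i dot (a i) (a i)) / #|J|%:R <=
    dot (S + a j) (S + a j).
Proof.
move=> a0; pose f j := dot (S + a j) (S + a j).
have J0 : 0 < #|J|%:R :> R by rewrite ltr0n; apply/card_gt0P; exists j0.
have [j _ maxj] := @arg_maxP _ _ _ j0 xpredT f isT.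
exists j; rewrite -(ler_pM2r J0) mulrDl divfK ?gt_eqF//.
have -> : dot S S * #|J|%:R + \sum_i dot (a i) (a i) = \sum_i f i.
  have sumE : \sum_i f i =
      \sum_i (dot S S + 2 * dot S (a i) + dot (a i) (a i)).
    by apply: eq_bigr => i _; rewrite /f !(dotDl, dotDr) (dotC (a i) S); ring.
  rewrite sumE !big_split /= sumr_const -mulr_sumr -dot_sumr a0 dot0r mulr0.
  by rewrite addr0 mulr_natr.
apply: (@le_trans _ _ (\sum_(i : J) f j)).
  by apply: ler_sum => i _; exact: maxj.
by rewrite sumr_const mulr_natr.
Qed.

(** For independent uniform choices in each block, the squared norm has the
    left-hand side as its expectation; choosing the blocks one at a time avoids
    the product space. *)
Lemma exists_far_vertex (B : eqType) (J : finType) (j0 : J)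
    (a : B -> J -> 'cV[R]_n) (w : 'cV[R]_n) (r : seq B) :
  (forall b, \sum_j a b j = 0) -> uniq r ->
  exists f : B -> J,
    dot w w + (\sum_(b <- r) \sum_j dot (a b j) (a b j)) / #|J|%:R <=
    dot (w + \sum_(b <- r) a b (f b)) (w + \sum_(b <- r) a b (f b)).
Proof.
move=> a0; elim: r => [_|b r IHr /= /andP[br ur]].
  by exists (fun=> j0); rewrite !big_nil mul0r !addr0.
have [f fP] := IHr ur.
have [j jP] := exists_far_translate j0 (w + \sum_(c <- r) a c (f c)) (a0 b).
exists (fun c => if c == b then j else f c).
rewrite !big_cons eqxx.
have -> : \sum_(c <- r) a c (if c == b then j else f c) =
    \sum_(c <- r) a c (f c).
  by apply: eq_big_seq => c cr; case: eqP => // cb; rewrite -cb cr in br.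
rewrite [a b j + _]addrC addrA; apply: le_trans jP.
by move: fP; rewrite mulrDl; lra.
Qed.

End Averaging.

Section Sharpness.
Context {R : realType} {k s : nat}.
Hypotheses (k_gt0 : (0 < k)%N) (s_gt0 : (0 < s)%N).
Let K := @simplex_product R k s.

Let s0 : 0 < s%:R :> R.
Proof. by rewrite ltr0n. Qed.

(** For the lower bound, [Kc] is applied to the vertex opposite to each facet of a
    block; summing over the facets removes the center [c]. *)
Lemma asymmetry_simplex_product : minkowski_asymmetry K = s%:R.
Proof.
have sK : asymmetry_ratio K s%:R.
  split; first exact: ltW.
  exists 0 => _ [x Kx <-]; exists (- (s%:R^-1 *: x)).
    move=> b j; rewrite dotNr dotZr lerNl -ler_pdivrMl ?invr_gt0// invrK mulrN1.
    exact: normal_ge.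
  by rewrite subr0 sub0r opprK scalerA divff ?gt_eqF// scale1r.
apply/eqP; rewrite eq_le; apply/andP; split.
  by apply: ge_inf => //; exists 0 => t [].
apply: lb_le_inf; first by exists s%:R.
move=> rho [rho0 [c Kc]]; pose b0 : 'I_k := Ordinal k_gt0.
have h j : - s%:R - dot (normal b0 j) c >= rho * dot (normal b0 j) c - rho.
  pose x := \sum_b @vertex R k s b j.
  have [|y Ky yE] := Kc (x - c).
    exists x => //; exact: (sum_vertices_in (fun=> j)).
  have : dot (normal b0 j) (rho *: (c - y)) = dot (normal b0 j) (x - c).
    by rewrite yE.
  rewrite dotZr !dotDr !dotNr.
  rewrite (vertex_in_simplex_product (fun=> j)) eqxx mulr1 -natr1.
  have := ler_wpM2l rho0 (Ky b0 j); lra.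
have : \sum_j (rho * dot (@normal R k s b0 j) c - rho) <=
    \sum_j (- s%:R - dot (@normal R k s b0 j) c).
  by apply: ler_sum => j _; exact: h.
rewrite !sumrB -mulr_sumr.
have -> : \sum_j dot (@normal R k s b0 j) c = 0.
  under eq_bigr do rewrite dotC.
  by rewrite -dot_sumr sum_normal dot0r.
rewrite mulr0 sub0r subr0 !sumr_const card_ord mulNrn lerN2.
by rewrite lerMn2r.
Qed.

(** The tangent at [g = 1 / m] to the convex function [t |-> t^(-1/2)] of
    [t = g^2]. *)
Lemma inv_tangent_ge (m g : R) : 0 < g -> 0 <= m ->
  m * (3 - m ^+ 2 * g ^+ 2) / 2 <= g^-1.
Proof.
move=> g0 m0; rewrite -[leRHS]mul1r ler_pdivlMr// mulrAC ler_pdivrMr// mul1r.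
have : 0 <= (m * g - 1) ^+ 2 * (m * g + 2).
  by rewrite mulr_ge0 ?sqr_ge0// addr_ge0// mulr_ge0// ltW.
by lra.
Qed.

(** The ellipsoid contains the translated vertices and lies in a dilate of the
    product.  The first fact bounds the sum of the [g b j ^+ 2], the second one
    bounds each [s / g b j] by testing the facet normal at the boundary point of
    the ellipsoid in the direction of the facet opposite to the vertex. *)
Lemma bm_ratio_simplex_product rho :
  bm_ratio K (@euclidean_ball R (k * s)) rho -> s%:R * Num.sqrt k%:R <= rho.
Proof.
move=> [rho0 [A [u [v [Au Kin Kout]]]]].
pose a b j := invmx A *m @vertex R k s b j.
have a_sum b : \sum_j a b j = 0.
  by rewrite -mulmx_sumr sum_vertex mulmx0.
have sum_a : \sum_b \sum_j dot (a b j) (a b j) <= s.+1%:R.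
  have [f fP] := exists_far_vertex (ord0 : 'I_s.+1) (invmx A *m u) a_sum
    (index_enum_uniq 'I_k).
  have [|y /in_euclidean_ball yball yE] := Kin (u + \sum_b vertex b (f b)).
    by exists (\sum_b vertex b (f b)) => //; exact: sum_vertices_in.
  move: fP; rewrite -mulmx_sumr -mulmxDr -yE mulKmx// card_ord => fP.
  rewrite -[leRHS]mul1r -ler_pdivrMr ?ltr0n//.
  apply: le_trans yball; apply: le_trans fP.
  by rewrite lerDr dot_ge0.
pose g b j := Num.sqrt (dot (a b j) (a b j)).
have g0 b j : 0 < g b j.
  rewrite sqrtr_gt0 dot_gt0; apply/eqP => aE.
  have : dot (@normal R k s b j) (vertex b j) = 0.
    by rewrite -(mulKVmx Au (vertex b j)) -/(a b j) aE mulmx0 dot0r.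
  rewrite dot_normal_vertex// !eqxx mul1r mulr1 -natr1 => /eqP.
  by rewrite opprD addrCA subrr addr0 oppr_eq0 gt_eqF.
have gE b j : g b j ^+ 2 = dot (a b j) (a b j) by rewrite sqr_sqrtr// dot_ge0.
have h b j : s%:R * (g b j)^-1 <= dot (normal b j) v + rho.
  have [|x Kx xE] := Kout (A *m (- ((g b j)^-1 *: a b j))).
    exists (- ((g b j)^-1 *: a b j)) => //; apply/in_euclidean_ball.
    rewrite dotNl dotNr opprK dotZl dotZr -gE expr2 mulrA.
    by rewrite mulrACA -expr2 mulVf ?gt_eqF// expr1n.
  have := congr1 (dot (normal b j)) xE.
  rewrite dotDr dotZr mulmxN -scalemxAr mulKVmx// dotNr dotZr.
  rewrite dot_normal_vertex// !eqxx mul1r mulr1 -natr1.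
  have := ler_wpM2l rho0 (Kx b j); lra.
(* The bound on sum_a makes the mean of [g b j ^+ 2] at most [1 / k], and the
   tangent is taken there. *)
pose m : R := Num.sqrt k%:R.
have k0 : 0 < k%:R :> R by rewrite ltr0n.
have m2 : m ^+ 2 = k%:R by rewrite sqr_sqrtr// ltW.
have m0 : 0 <= m by exact: sqrtr_ge0.
have sum_h : \sum_b \sum_j s%:R * (m * (3 - m ^+ 2 * g b j ^+ 2) / 2) <=
    \sum_b \sum_j (dot (@normal R k s b j) v + rho).
  apply: ler_sum => b _; apply: ler_sum => j _; apply: le_trans (h b j).
  by rewrite ler_wpM2l ?ler0n// inv_tangent_ge.
have rhsE : \sum_b \sum_j (dot (@normal R k s b j) v + rho) =
    k%:R * (s.+1%:R * rho).
  under eq_bigr => b _.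
    rewrite big_split sumr_const card_ord /=.
    have -> : \sum_j dot (@normal R k s b j) v = 0.
      under eq_bigr do rewrite dotC.
      by rewrite -dot_sumr sum_normal dot0r.
    rewrite add0r.
    over.
  by rewrite sumr_const card_ord -[_ *+ k]mulr_natl -[rho *+ _]mulr_natl.
have lhsE : \sum_b \sum_j s%:R * (m * (3 - m ^+ 2 * g b j ^+ 2) / 2) =
    s%:R * m / 2 * (3 * (k%:R * s.+1%:R) -
      k%:R * \sum_b \sum_j dot (a b j) (a b j)).
  have -> : 3 * (k%:R * s.+1%:R) = \sum_(b < k) \sum_(j < s.+1) (3 : R).
    under eq_bigr do rewrite sumr_const card_ord.
    by rewrite sumr_const card_ord -mulrnA -[RHS]mulr_natr mulnC natrM.
  rewrite mulr_sumr -sumrB mulr_sumr; apply: eq_bigr => b _.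
  rewrite mulr_sumr -sumrB mulr_sumr; apply: eq_bigr => j _.
  by rewrite gE m2; ring.
rewrite lhsE rhsE in sum_h.
have s1 : 0 < s.+1%:R :> R by rewrite ltr0n.
rewrite -(ler_pM2l s1) -(ler_pM2l k0); apply: le_trans sum_h.
have : 0 <= s%:R * m / 2 * k%:R * (s.+1%:R - \sum_b \sum_j dot (a b j) (a b j)).
  by rewrite mulr_ge0 ?subr_ge0// !mulr_ge0// ltW.
by rewrite -/m; lra.
Qed.

Lemma banach_mazur_simplex_product :
  banach_mazur_distance K (@euclidean_ball R (k * s)) =
    Num.sqrt ((k * s)%:R * s%:R).
Proof.
have ks0 : (0 < k * s)%N by rewrite muln_gt0 k_gt0.
have bodyK : convex_body K by exact: simplex_product_body.
apply/eqP; rewrite eq_le; apply/andP; split.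
  by rewrite -asymmetry_simplex_product; exact: banach_mazur_ball_le.
apply: lb_le_inf.
  have [rho rhoK] := asymmetry_ratio_exists bodyK.
  exists (Num.sqrt ((k * s)%:R * rho)).
  exact: bm_ratio_of_asymmetry.
move=> rho /bm_ratio_simplex_product; congr (_ <= _).
have -> : (k * s)%:R * s%:R = s%:R ^+ 2 * k%:R :> R by rewrite natrM; ring.
by rewrite sqrtrM ?sqr_ge0// sqrtr_sqr ger0_norm// ltW.
Qed.

End Sharpness.

Unset Implicit Arguments.

Theorem theorem1p3 (R : realType) (n : nat) (n_gt0 : (0 < n)%N) :
  (forall K : set 'cV[R]_n, convex_body K ->
     banach_mazur_distance K (@euclidean_ball R n)
       <= Num.sqrt (n%:R * minkowski_asymmetry K))
  /\
  (forall s : nat, (0 < s)%N -> (s %| n)%N ->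
     exists K : set 'cV[R]_n,
       [/\ convex_body K,
           minkowski_asymmetry K = s%:R &
           banach_mazur_distance K (@euclidean_ball R n)
             = Num.sqrt (n%:R * s%:R)]).
Proof.
split=> [K|s s_gt0 /dvdnP[k nE]]; first exact: banach_mazur_ball_le.
move: n_gt0; rewrite {n}nE muln_gt0 => /andP[k_gt0 _].
exists (@simplex_product R k s); split.
- exact: simplex_product_body.
- exact: asymmetry_simplex_product.
- exact: banach_mazur_simplex_product.
Qed.
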